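(* Let $\Delta$ be a pure $d$-dimensional simplicial complex. Then $\Delta$ is strongly shellable if and only if there exists an $h$-assignment $A$ of $\Delta$ such that all facets of $\Delta$ can be removed by successively applying removing steps, where at each step the facet removed is a strong candidate facet of the current complex with respect to the current (restricted) assignment.
   Context: A simplicial complex is a finite family of subsets of a vertex set closed under taking subsets; $\mathcal{F}(\Delta)$ is its set of facets, $\dim(A)=|A|-1$; $\Delta$ is pure if all facets have the same dimension. A linear order $F_1,\dots,F_t$ of $\mathcal{F}(\Delta)$ is a strong shelling order if for every $1\le i<j\le t$ there exists $k$ with $1\le k<j$ such that $|F_j\setminus F_k|=1$, $F_j\setminus F_k\subseteq F_j\setminus F_i$, and $F_k\setminus F_j\subseteq F_i$; $\Delta$ is strongly shellable if such an order exists. For facets $F,G$ of a pure complex, $\operatorname{dis}(F,G)=|F\setminus G|$. Let $\mathbf{h}(\Delta)=(h_0(\Delta),\dots,h_{d+1}(\Delta))$ be the (standard) $h$-vector of $\Delta$. A ridge is a $(d-1)$-dimensional face; a boundary ridge is a ridge contained in exactly one facet. An $h$-assignment of $\Delta$ is a map $A:\mathcal{F}(\Delta)\to\{0,1,\dots,d+1\}$ with $|A^{-1}(i)|=h_i(\Delta)$ for each $i$. Given a pure complex $\Delta'$ and a map $A$ on $\mathcal{F}(\Delta')$, a facet $F$ of $\Delta'$ is a candidate facet if $F$ contains exactly $d+1-A(F)$ boundary ridges of $\Delta'$; it is a strong candidate facet if moreover for every facet $G\neq F$ of $\Delta'$ there is a facet $H$ of $\Delta'$ with $\operatorname{dis}(F,H)=1$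 and $\operatorname{dis}(G,H)=\operatorname{dis}(G,F)-1$. A removing step applied to a candidate facet $F$ replaces $\Delta'$ by the complex generated by $\mathcal{F}(\Delta')\setminus\{F\}$ and $A$ by its restriction to the remaining facets. *)

(* Defs.v *)
From mathcomp Require Import all_boot all_order all_algebra.

Set Implicit Arguments.
Unset Strict Implicit.
Unset Printing Implicit Defensive.

Import Order.TTheory GRing.Theory Num.Theory.
Local Open Scope ring_scope.

Definition simplicial_complex (V : finType) (D : {set {set V}}) : Prop :=
  forall B C : {set V}, B \subset C -> C \in D -> B \in D.

Definition facets (V : finType) (D : {set {set V}}) : {set {set V}} :=
  [set F | maxset (fun B => B \in D) F].

(* Integer-valued, so that the empty face has dimension -1. *)
Definition dim (V : finType) (B : {set V}) : int := #|B|%:Z - 1.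

Definition max_face_card (V : finType) (D : {set {set V}}) : nat :=
  \max_(B in D) #|B|.

(* Meaningful only for D != set0; {set0} has dimension -1. *)
Definition complex_dim (V : finType) (D : {set {set V}}) : int :=
  (max_face_card D)%:Z - 1.

Definition pure (V : finType) (D : {set {set V}}) : Prop :=
  forall F G : {set V}, F \in facets D -> G \in facets D -> dim F = dim G.

Definition strong_shelling_order (V : finType) (s : seq {set V}) : Prop :=
  forall i j : nat, (i < j < size s)%N ->
  let F := nth set0 s in
  exists k : nat, [/\ (k < j)%N,
    #|F j :\: F k| = 1%N,
    F j :\: F k \subset F j :\: F i &
    F k :\: F j \subset F i].

Definition strongly_shellable (V : finType) (D : {set {set V}}) : Prop :=
  exists s : seq {set V},
    [/\ uniq s, s =i facets D & strong_shelling_order s].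

Definition dis (V : finType) (F G : {set V}) : nat := #|F :\: G|.

(* The number of faces with k vertices, i.e. f_{k-1} of the f-vector. *)
Definition face_count (V : finType) (D : {set {set V}}) (k : nat) : nat :=
  #|[set B in D | #|B| == k]|.

(* With n = dim D + 1 :  sum_k f_{k-1} x^k (1-x)^{n-k} = sum_i h_i x^i. *)
Definition h_poly (V : finType) (D : {set {set V}}) : {poly int} :=
  \sum_(k < (max_face_card D).+1)
     (face_count D k)%:R *: ('X^k * (1 - 'X) ^+ (max_face_card D - k)).

Definition h_entry (V : finType) (D : {set {set V}}) (i : nat) : int :=
  (h_poly D)`_i.

(* Maps on facets are represented by functions on all of {set V}: only their
   values on facets are ever used, so restricting an assignment to fewer facets
   leaves the function unchanged. *)
Definition h_assignment (V : finType) (d : int) (D : {set {set V}})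
    (A : {set V} -> nat) : Prop :=
  (forall F, F \in facets D -> (A F)%:Z <= d + 1) /\
  (forall i : nat, i%:Z <= d + 1 ->
     #|[set F in facets D | A F == i]|%:Z = h_entry D i).

Definition ridge (V : finType) (d : int) (D : {set {set V}}) (R : {set V})
    : bool :=
  (R \in D) && (dim R == d - 1).

Definition boundary_ridge (V : finType) (d : int) (D : {set {set V}})
    (R : {set V}) : bool :=
  ridge d D R && (#|[set F in facets D | R \subset F]| == 1%N).

Definition candidate (V : finType) (d : int) (A : {set V} -> nat)
    (D : {set {set V}}) (F : {set V}) : Prop :=
  F \in facets D /\
  #|[set R | boundary_ridge d D R & R \subset F]|%:Z = d + 1 - (A F)%:Z.

Definition strong_candidate (V : finType) (d : int) (A : {set V} -> nat)
    (D : {set {set V}}) (F : {set V}) : Prop :=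
  candidate d A D F /\
  forall G, G \in facets D -> G != F ->
    exists H, [/\ H \in facets D, dis F H = 1%N &
                  (dis G H)%:Z = (dis G F)%:Z - 1].

Definition generated (V : finType) (X : {set {set V}}) : {set {set V}} :=
  [set B : {set V} | [exists F in X, B \subset F]].

Definition remove_facet (V : finType) (D : {set {set V}}) (F : {set V})
    : {set {set V}} :=
  generated (facets D :\ F).

Inductive strongly_removable (V : finType) (d : int) (A : {set V} -> nat)
    : {set {set V}} -> Prop :=
| all_removed D : facets D = set0 -> strongly_removable d A D
| removing_step D F : strong_candidate d A D F ->
    strongly_removable d A (remove_facet D F) -> strongly_removable d A D.

(* Main.v *)
Require Import Defs.
From mathcomp Require Import all_boot all_order all_algebra.
From mathcomp Require Import zify.

(** For equicardinal [F], [G], [H] with [H = F - v + w], passing from [F] to [H]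
    decreases the distance to [G] exactly when [v] is not in [G] and [w] is.
    Hence a facet satisfies the strong shelling condition with respect to its
    predecessors iff it satisfies the distance condition of a strong candidate
    in the complex which they generate together, and a strong removal order is
    a strong shelling order read backwards.

    For the assignment, let [R_j] be the set of [v] in [F_j] such that
    [F_j - v] lies in an earlier facet. The intervals [[R_j, F_j]] partition the
    faces, so [h_poly] is the sum of the [X ^ |R_j|] and [F_j |-> |R_j|] is an
    h-assignment; the boundary ridges in [F_j] when it is removed are the
    [F_j - v] with [v] outside [R_j]. *)

Set Implicit Arguments.
Unset Strict Implicit.
Unset Printing Implicit Defensive.

Import GRing.Theory.

Section StrongShellings.

Variable V : finType.
Implicit Types (D X : {set {set V}}) (B F G H R : {set V}) (s p : seq {set V}).
Implicit Types (n i j k : nat) (u v w : V).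

(** * The exchange condition in strong shellings *)

Definition exchange F G H : bool :=
  [&& #|F :\: H| == 1, F :\: H \subset F :\: G & H :\: F \subset G].

Lemma exchangeE F G H : #|F| = #|H| ->
  exchange F G H = (dis F H == 1) && ((dis G H).+1 == dis G F).
Proof.
rewrite /exchange /dis => eqFH; case: eqP => //= FH1.
have HF1 : #|H :\: F| = 1.
  by have := cardsID H F; have := cardsID F H; rewrite setIC; lia.
have /cards1P[v Fv] := introT eqP FH1; have /cards1P[w Hw] := introT eqP HF1.
have /setDP[vF vH] : v \in F :\: H by rewrite Fv set11.
have /setDP[wH wF] : w \in H :\: F by rewrite Hw set11.
(* Both distances from [G] then count the same set [G :\: (w |: F)], plus one if [w] (for [F]) or
   [v] (for [H]) lies in [G]. *)
have FvE : w |: F = v |: H.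
  apply/setP=> u; move/setP/(_ u): Fv; move/setP/(_ u): Hw; rewrite !inE.
  by move=> <- <-; case: (u \in F); case: (u \in H).
rewrite Fv Hw !sub1set !inE vF andbT.
have countF : #|G :\: F| = (w \in G) + #|G :\: (w |: F)|.
  by rewrite (cardsD1 w) !inE wF /=; congr (_ + #|pred_of_set _|);
    apply/setP=> u; rewrite !inE negb_or andbA.
have countH : #|G :\: H| = (v \in G) + #|G :\: (w |: F)|.
  rewrite (cardsD1 v) !inE vH /=; congr (_ + #|pred_of_set _|).
  by rewrite FvE; apply/setP=> u; rewrite !inE negb_or andbA.
by rewrite countF countH; case: (v \in G); case: (w \in G) => /=; lia.
Qed.

(** Replaces the index of the witness by membership in the prefix of predecessors, so that later
    arguments depend only on a set of earlier facets. *)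
Lemma strong_shelling_orderP s :
  strong_shelling_order s <->
  forall i j, i < j < size s -> exists2 H, H \in take j s &
    exchange (nth set0 s j) (nth set0 s i) H.
Proof.
split=> shell i j ij; have /andP[ltij ltjs] := ij.
  have [k [ltkj c1 c2 c3]] := shell i j ij.
  exists (nth set0 s k); last by apply/and3P; split=> //; apply/eqP.
  by rewrite -(nth_take _ ltkj) mem_nth // size_takel ?(ltnW ltjs).
have [H /(nthP set0)[k]] := shell i j ij.
rewrite size_takel ?(ltnW ltjs) // => ltkj; rewrite nth_take // => <-.
by move=> /and3P[/eqP c1 c2 c3]; exists k.
Qed.

Lemma strong_shelling_order_rcons s F :
  strong_shelling_order s ->
  (forall G, G \in s -> exists2 H, H \in s & exchange F G H) ->
  strong_shelling_order (rcons s F).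
Proof.
move=> /strong_shelling_orderP shell last_ex.
apply/strong_shelling_orderP => i j /andP[ltij].
rewrite size_rcons ltnS leq_eqVlt => /predU1P[ejs | ltjs].
  rewrite ejs -cats1 take_size_cat // !nth_cat ltnn subnn /= -ejs ltij.
  by apply: last_ex; rewrite mem_nth -?ejs.
rewrite -cats1 takel_cat ?(ltnW ltjs) // !nth_cat ltjs (ltn_trans ltij ltjs).
by apply: shell; rewrite ltij.
Qed.

(** * Facets of generated and of pure complexes *)

Lemma facet_face D F : F \in facets D -> F \in D.
Proof. by rewrite inE => /maxsetp. Qed.

Lemma face_sub_facet D B : B \in D -> exists2 F, F \in facets D & B \subset F.
Proof.
move=> BD; have [F maxF subBF] := @maxset_exists _ (fun B => B \in D) B BD.
by exists F; rewrite ?inE.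
Qed.

(** Sets of equal cardinality form an antichain, so every member of [X] is maximal. *)
Lemma facets_generated n X : {in X, forall F, #|F| = n} ->
  facets (generated X) = X.
Proof.
move=> cardX; apply/setP=> F; rewrite inE.
apply/maxsetP/idP => [[] | FX].
  rewrite inE => /exists_inP[G GX subFG] maxF.
  suff <- : G = F by [].
  by apply: maxF => //; rewrite inE; apply/exists_inP; exists G.
split=> [|G]; first by rewrite inE; apply/exists_inP; exists F.
rewrite inE => /exists_inP[H HX subGH] subFG.
apply/esym/eqP; rewrite eqEcard subFG (cardX F) // -(cardX H) //.
exact: subset_leq_card.
Qed.

Lemma generated_facets D : simplicial_complex D -> generated (facets D) = D.
Proof.
move=> cplxD; apply/setP=> B; rewrite inE; apply/exists_inP/idP.
  by case=> F /facet_face FD subBF; apply: cplxD FD.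
by move=> /face_sub_facet.
Qed.

(** A face of maximal cardinality lies in some facet, and purity carries the cardinality of that
    facet to all others. *)
Lemma pure_card D : D != set0 -> pure D ->
  {in facets D, forall F, #|F| = max_face_card D}.
Proof.
move=> /set0Pn[B0 B0D] pureD F FD.
have [B BD maxB] : exists2 B, B \in D & #|B| = max_face_card D.
  have cardD_gt0 : 0 < #|[pred B in D]| by apply/card_gt0P; exists B0.
  by have [B] := eq_bigmax_cond (fun B => #|B|) cardD_gt0; exists B.
have [G GD subBG] := face_sub_facet BD.
have eqFG : #|F| = #|G| by have /addIr[] := pureD _ _ FD GD.
rewrite eqFG; apply/eqP; rewrite eqn_leq -{2}maxB subset_leq_card // andbT.
exact/leq_bigmax_cond/facet_face.
Qed.

(** Induction on the removal: the facet removed first is appended last to a shelling of the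
    remaining facets. *)
Lemma strongly_shellable_of_removable n (d : int) (A : {set V} -> nat) D :
  {in facets D, forall F, #|F| = n} ->
  strongly_removable d A D -> strongly_shellable D.
Proof.
move=> cardD rem; elim: rem cardD => {D} [D D0 _ | D F cand _ IH cardD].
  by exists [::]; split=> // [B | i j]; rewrite ?D0 ?inE // andbF.
case: cand => -[FD _] cand.
have facetsR : facets (remove_facet D F) = facets D :\ F.
  by apply: (@facets_generated n) => G /setD1P[_ /cardD].
have [|s [uniq_s sE shell]] := IH.
  by rewrite facetsR => G /setD1P[_ /cardD].
have {}sE B : B \in s = (B != F) && (B \in facets D) by rewrite sE facetsR in_setD1.
exists (rcons s F); split.
- by rewrite rcons_uniq uniq_s sE eqxx.
- by move=> B; rewrite mem_rcons inE sE; case: eqP => // ->; rewrite FD.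
- apply: strong_shelling_order_rcons => // G; rewrite sE => /andP[neGF GD].
  have [H [HD FH1 GH]] := cand G GD neGF.
  exists H.
    (* [H] differs from [F], as [dis F F] is 0, hence it survives the removal. *)
    rewrite sE HD andbT; apply: contra_eqN FH1 => /eqP->.
    by rewrite /dis setDv cards0.
  by rewrite exchangeE ?(cardD F) ?(cardD H) // FH1 /=; lia.
Qed.

(** * Restriction sets and boundary ridges *)

Definition restriction p F : {set V} :=
  [set v in F | has (fun G => F :\ v \subset G) p].

Lemma restriction_sub p F : restriction p F \subset F.
Proof. by apply/subsetP => v; rewrite inE => /andP[]. Qed.

(** If [B] lies in an earlier [G], exchange yields a [v] in the restriction but outside [G], hence
    outside [B]. Conversely, a [v] in the restriction missing from [B] puts [B] inside [F :\ v],
    hence inside an earlier facet. *)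
Lemma restriction_subset p F B :
  (forall G, G \in p -> exists2 H, H \in p & exchange F G H) ->
  B \subset F ->
  (restriction p F \subset B) = ~~ has (fun G => B \subset G) p.
Proof.
move=> exF subBF; apply/subsetP/hasPn => [subRB G Gp | notB v].
  apply/negP => subBG; have [H Hp /and3P[/cards1P[v FHv] subFHG _]] := exF G Gp.
  have: v \in F :\: G by rewrite (subsetP subFHG) // FHv set11.
  case/setDP=> vF /negP[]; apply: (subsetP subBG); apply: subRB.
  rewrite inE vF; apply/hasP; exists H => //.
  apply/subsetP=> u /setD1P[neuv uF]; apply: contraNT neuv => uH.
  by rewrite -in_set1 -FHv inE uH.
rewrite inE => /andP[vF /hasP[G Gp subFG]]; apply: contraT => vB.
case/negP: (notB G Gp); apply: subset_trans subFG.
by rewrite subsetD1 subBF.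
Qed.

Lemma card_boundary_ridges n (d : int) p F :
  d = (n%:Z - 1)%R -> F \notin p -> {in F :: p, forall G, #|G| = n} ->
  #|[set R | boundary_ridge d (generated [set G in F :: p]) R & R \subset F]|
    + #|restriction p F| = n.
Proof.
move=> dE Fp cardFp.
have facetsE : facets (generated [set G in F :: p]) = [set G in F :: p].
  by apply: (@facets_generated n) => G; rewrite in_set => /cardFp.
have cardF : #|F| = n by apply: cardFp; rewrite mem_head.
have ->: [set R | boundary_ridge d (generated [set G in F :: p]) R & R \subset F]
    = [set F :\ v | v in F :\: restriction p F].
  apply/setP=> R; rewrite inE /boundary_ridge /ridge facetsE /Defs.dim dE.
  apply/idP/imsetP => [/andP[/andP[/andP[_ /eqP cardR] /cards1P[G1 G1E]] subRF]|].
    have/cards1P[v FRv] : #|F :\: R| == 1.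
      by rewrite cardsDS // cardF; lia.
    have RE : R = F :\ v by rewrite -FRv setDDr setDv set0U; apply/esym/setIidPr.
    have /setDP[vF vR] : v \in F :\: R by rewrite FRv set11.
    exists v => //; rewrite inE vF andbT inE vF; apply/hasP => -[G Gp].
    rewrite -RE => subRG.
    (* [F] and [G] both contain the boundary ridge [R], so they coincide, against [F \notin p]. *)
    have: F \in [set G1] by rewrite -G1E !inE eqxx.
    have: G \in [set G1] by rewrite -G1E !inE Gp orbT.
    by rewrite !inE => /eqP GG1 /eqP FG1; case/negP: Fp; rewrite FG1 -GG1.
  case=> v; rewrite !inE => /andP[notR vF] ->.
  rewrite vF /= in notR.
  rewrite subD1set andbT; rewrite -andbA; apply/and3P; split.
  - by apply/exists_inP; exists F; rewrite ?inE ?eqxx // subD1set.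
  - by have := cardsD1 v F; rewrite vF cardF; lia.
  - apply/cards1P; exists F; apply/setP=> G; rewrite !inE.
    case: eqP => [->|_] /=; first by rewrite subD1set.
    by apply: contraNF notR => /andP[Gp subG]; apply/hasP; exists G.
rewrite card_in_imset ?cardsDS ?restriction_sub // ?cardF.
  by rewrite subnK // -cardF subset_leq_card // restriction_sub.
move=> v w /setDP[vF _] /setDP[wF _] /setP/(_ v).
by rewrite !inE eqxx vF !andbT => /esym/negbFE/eqP.
Qed.

(** * The h-polynomial of a strong shelling *)

Local Open Scope ring_scope.

(** Expand a product over all vertices whose factor is [x + 0] on [R], [x + (1 - x)] on the rest of
    [F] and [0 + 1] outside [F]. The term choosing the first summand exactly on [B] vanishes unless
    [B] lies between [R] and [F]. *)
Lemma interval_sum (K : comNzRingType) (x : K) R F : R \subset F ->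
  \sum_(B : {set V} | (R \subset B) && (B \subset F))
     x ^+ #|B| * (1 - x) ^+ (#|F| - #|B|) = x ^+ #|R|.
Proof.
move=> subRF.
pose a v : K := if v \in F then x else 0.
pose b v : K := if v \in R then 0 else if v \in F then 1 - x else 1.
transitivity (\prod_v (a v + b v)); last first.
  rewrite -prodr_const [RHS]big_mkcond /=; apply: eq_bigr => v _.
  rewrite /a /b; have [vR | _] := boolP (v \in R).
    by rewrite (subsetP subRF) // addr0.
  by case: ifP => _; rewrite ?add0r // addrC subrK.
rewrite bigA_distr [LHS]big_mkcond /=; apply: eq_bigr => B _.
have [/andP[subRB subBF] | notRBF] := ifPn.
  rewrite -cardsDS // -!prodr_const [in RHS](bigID (mem B)) /=; congr (_ * _).
    by apply: eq_bigr => v vB; rewrite vB /a (subsetP subBF).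
  rewrite big_mkcond [RHS]big_mkcond; apply: eq_bigr => v _.
  rewrite inE; have [// | vB] /= := boolP (v \in B); rewrite /b [in RHS]ifN //.
  exact: contra (subsetP subRB v) vB.
apply/esym; move: notRBF; rewrite negb_and => /orP[] /subsetPn[v].
  by move=> vR vB; rewrite (bigD1 v) //= (negPf vB) /b vR mul0r.
by move=> vB vF; rewrite (bigD1 v) //= vB /a (negPf vF) mul0r.
Qed.

Lemma h_polyE D :
  h_poly D = \sum_(B in D) 'X^#|B| * (1 - 'X) ^+ (max_face_card D - #|B|).
Proof.
have ltB B : B \in D -> (#|B| < (max_face_card D).+1)%N.
  by move=> BD; rewrite ltnS; apply: leq_bigmax_cond.
rewrite (partition_big (fun B => inord #|B| : 'I_(max_face_card D).+1) xpredT) //=.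
apply: eq_bigr => k _; rewrite scaler_nat /face_count -sumr_const.
apply: eq_big => [B | B].
  rewrite inE; case BD: (B \in D) => //=.
  by rewrite -val_eqE /= inordK // ltB.
by rewrite inE => /andP[_ /eqP->].
Qed.

Definition restriction_card s F : nat := #|restriction (take (index F s) s) F|.

(** Each face is sent to the first facet containing it; the fibre over [F] is the interval from its
    restriction to [F], which [interval_sum] evaluates. *)
Lemma h_poly_shelling s D :
  simplicial_complex D -> {in facets D, forall F, #|F| = max_face_card D} ->
  uniq s -> s =i facets D -> strong_shelling_order s ->
  h_poly D = \sum_(F in facets D) 'X^(restriction_card s F).
Proof.
move=> cplxD cardD uniq_s sE /strong_shelling_orderP shell.
pose first B := nth set0 s (find (fun F => B \subset F) s).
have has_facet B : B \in D -> has (fun F => B \subset F) s.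
  by move=> /face_sub_facet[F FD subBF]; apply/hasP; exists F; rewrite ?sE.
rewrite h_polyE (partition_big first (mem (facets D))) => [|B BD] /=; last first.
  by rewrite -sE mem_nth // -has_find has_facet.
apply: eq_bigr => F FD; rewrite /restriction_card.
rewrite -(interval_sum _ (restriction_sub (take (index F s) s) F)).
rewrite (cardD F) //; apply: eq_bigl => B.
have ltFs : (index F s < size s)%N by rewrite index_mem sE.
have nthF : nth set0 s (index F s) = F by rewrite nth_index // sE.
have [subBF | notBF] := boolP (B \subset F); last first.
  rewrite andbF; apply: contraNF notBF => /andP[BD /eqP<-].
  exact: (nth_find _ (has_facet B BD)).
have BD : B \in D := cplxD _ _ subBF (facet_face FD).
rewrite BD andbT restriction_subset // => [|G /(nthP set0)[i]]; last first.
  rewrite size_takel ?(ltnW ltFs) // => ltiF; rewrite nth_take // => <-.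
  by rewrite -{2}nthF; apply: shell; rewrite ltiF.
have ltfs : (find (fun G => B \subset G) s < size s)%N by rewrite -has_find has_facet.
(* The absence of [B] from earlier facets says that its first position is at least that of [F]; the
   reverse inequality holds because [F] contains [B]. *)
rewrite /first -{1}nthF nth_uniq //= has_take // -?has_find ?has_facet // -leqNgt.
rewrite eqn_leq andb_idl // => _; rewrite leqNgt; apply/negP => /(before_find set0).
by rewrite nthF subBF.
Qed.

Lemma h_assignment_restriction_card s D (d : int) :
  simplicial_complex D -> {in facets D, forall F, #|F| = max_face_card D} ->
  complex_dim D = d ->
  uniq s -> s =i facets D -> strong_shelling_order s ->
  h_assignment d D (restriction_card s).
Proof.
move=> cplxD cardD dimD uniq_s sE shell; split=> [F FD | i _].
  rewrite -dimD /complex_dim subrK lez_nat -(cardD F) //.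
  exact/subset_leq_card/restriction_sub.
rewrite /h_entry (h_poly_shelling cplxD cardD uniq_s sE shell) coef_sum.
under eq_bigr do rewrite coefXn.
rewrite -natr_sum -natz -sum1_card big_mkcond [in RHS]big_mkcond /=.
congr _%:R; apply: eq_bigr => F _; rewrite inE eq_sym.
by case: (_ \in _); case: eqP.
Qed.

(** * From strong shellings to strong removals *)

Lemma strongly_removable_of_shelling n (d : int) s :
  d = n%:Z - 1 -> uniq s -> {in s, forall F, #|F| = n} ->
  strong_shelling_order s ->
  strongly_removable d (restriction_card s) (generated [set F in s]).
Proof.
move=> dE uniq_s card_s /strong_shelling_orderP shell.
(* Only the complex shrinks to that of a prefix; the assignment remains the one computed from all of
   [s]. *)
rewrite -{2}(take_size s); elim: {-2}(size s) (leqnn (size s)) => [_ | m IH ltms].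
  apply: all_removed; rewrite take0 (@facets_generated n) => [|F].
    by apply/setP => F; rewrite !inE.
  by rewrite inE.
set p := take m s; pose F := nth set0 s m.
have pF : [set G in take m.+1 s] = [set G in F :: p].
  by apply/setP => G; rewrite !inE (take_nth set0) // mem_rcons inE.
have Fp : F \notin p.
  by move: (take_uniq m.+1 uniq_s); rewrite (take_nth set0) // rcons_uniq => /andP[].
have card_Fp : {in F :: p, forall G, #|G| = n}.
  move=> G; rewrite inE => /predU1P[-> | /mem_take]; apply: card_s.
  exact: mem_nth.
have facetsE : facets (generated [set G in F :: p]) = [set G in F :: p].
  by apply: (@facets_generated n) => G; rewrite in_set => /card_Fp.
rewrite pF; apply: (@removing_step _ _ _ _ F); last first.
  rewrite /remove_facet facetsE.
  have -> : [set G in F :: p] :\ F = [set G in p].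
    apply/setP => G; rewrite !inE; case: eqP => [-> | //].
    by rewrite (negPf Fp).
  by apply: IH; apply: ltnW.
split; first split.
- by rewrite facetsE !inE eqxx.
(* [F] stands at position [m] of [s], so its assigned value is the size of its restriction with
   respect to [p]. *)
- rewrite /restriction_card index_uniq // -/p.
  by have := card_boundary_ridges dE Fp card_Fp; rewrite dE; lia.
- rewrite facetsE => G; rewrite !inE => /predU1P[-> /eqP // | Gp] _.
  have [i ltim GE] : exists2 i, (i < m)%N & nth set0 s i = G.
    have /(nthP set0)[i] := Gp; rewrite size_takel ?(ltnW ltms) // => ltim.
    by rewrite nth_take //; exists i.
  have [|H Hp] := shell i m; first by rewrite ltim.
  rewrite GE -/F exchangeE ?card_Fp ?mem_head //; last by rewrite inE Hp orbT.
  case/andP=> /eqP FH1 /eqP GH.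
  by exists H; split=> //; [rewrite !inE Hp orbT | lia].
Qed.

End StrongShellings.

Theorem theorem7p2 (V : finType) (D : {set {set V}}) (d : int)
    (hcomplex : simplicial_complex D) (hnonempty : D != set0)
    (hpure : pure D) (hdim : complex_dim D = d) :
  strongly_shellable D <->
  exists A : {set V} -> nat, h_assignment d D A /\ strongly_removable d A D.
Proof.
have cardD := pure_card hnonempty hpure.
split=> [[s [uniq_s sE shell]] | [A [_ rem]]]; last first.
  exact: strongly_shellable_of_removable cardD rem.
exists (restriction_card s); split.
  exact: h_assignment_restriction_card.
have -> : D = generated [set F in s].
  rewrite -[LHS]generated_facets //; congr generated.
  by apply/setP => F; rewrite [RHS]in_set sE.
apply: strongly_removable_of_shelling (esym hdim) uniq_s _ shell.
by move=> F; rewrite sE; apply: cardD.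
Qed.
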